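(* Let $\lambda=(\lambda_n)_{n\ge1}\in W_0$, put $\Lambda_n:=\lambda_1+\cdots+\lambda_n$, and assume that $\Lambda_n\to\infty$ and that $(\lambda_n/\Lambda_n)_{n\ge1}$ is nonincreasing with limit $\eta\in[0,1)$. Let $f\colon(0,\infty)\to\mathbb{R}$ be a twice continuously differentiable function with nonvanishing first derivative, and put $\chi_f(x):=\frac{xf''(x)}{f'(x)}+1$ for $x>0$. Assume that the limit $p:=\lim_{x\to0^+}\chi_f(x)$ exists, is smaller than $1$, and that $\chi_f(x)\le p$ for all $x>0$. Then $\mathscr{H}_\lambda(\mathscr{A}_f)=C(p,\eta)$, where $$C(r,\eta):=\begin{cases}\left(\dfrac{\eta}{1-(1-\eta)^{1-r}}\right)^{1/r}, & \eta\in(0,1),\ r\ne0;\\[3mm](1-\eta)^{1-1/\eta}, & \eta\in(0,1),\ r=0;\\[1mm](1-r)^{-1/r}, & \eta=0,\ r\ne0;\\ e, & \eta=0,\ r=0,\end{cases}\qquad (r,\eta)\in(-\infty,1)\times[0,1).$$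
   Context: $W_n$ is the set of $(\lambda_1,\dots,\lambda_n)\in\mathbb{R}^n$ with all $\lambda_i\ge0$ and $\lambda_1+\cdots+\lambda_n>0$; $W_0$ is the set of real sequences $(\lambda_n)_{n\ge1}$ with $\lambda_1>0$ and $\lambda_n\ge0$ for $n\ge2$. For a continuous strictly monotone $f\colon(0,\infty)\to\mathbb{R}$, the weighted quasiarithmetic mean $\mathscr{A}_f\colon\bigcup_{n\ge1}(0,\infty)^n\times W_n\to(0,\infty)$ is $$\mathscr{A}_f(x,\lambda):=f^{-1}\left(\frac{\lambda_1f(x_1)+\cdots+\lambda_nf(x_n)}{\lambda_1+\cdots+\lambda_n}\right).$$ Hardy constant: $\mathscr{H}_\lambda(\mathscr{A}_f)$ is the smallest extended real number $C$ such that $\sum_{n=1}^\infty\lambda_n\,\mathscr{A}_f\big((x_1,\dots,x_n),(\lambda_1,\dots,\lambda_n)\big)\le C\sum_{n=1}^\infty\lambda_nx_n$ for all sequences $(x_n)$ in $(0,\infty)$. *)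

(* Defs.v *)
From HB Require Import structures.
From mathcomp Require Import all_boot all_order all_algebra.
From mathcomp Require Import all_classical all_reals all_analysis.
Set Implicit Arguments.
Unset Strict Implicit.
Unset Printing Implicit Defensive.
Import Order.TTheory GRing.Theory Num.Theory.
Import numFieldNormedType.Exports.
Local Open Scope ring_scope.
Local Open Scope classical_set_scope.

(* Sequences are indexed from 0: [lam n] is the paper's lambda_{n+1}. *)
Definition W0 (R : realType) (lam : R^nat) : Prop :=
  0 < lam 0%N /\ forall n, 0 <= lam n.

Definition partial_weight (R : realType) (lam : R^nat) (n : nat) : R :=
  \sum_(k < n.+1) lam k.

Definition weighted_mean (R : realType) :=
  forall n : nat, ('I_n -> R) -> ('I_n -> R) -> R.

(* Functions on (0, +oo) are total functions on R whose values outside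
   (0, +oo) are irrelevant; [pinv [set t | 0 < t] f] inverts the restriction of f,
   and the value is meaningful only for x > 0 and w >= 0 with w != 0. *)
Definition quasiarith_mean (R : realType) (f : R -> R) : weighted_mean R :=
  fun n x w =>
    pinv [set t : R | 0 < t] f ((\sum_(i < n) w i * f (x i)) / \sum_(i < n) w i).

(* The right-hand sum is positive (possibly +oo) as soon as lam is in W0, so
   the convention 0 * +oo = 0 can only matter for C = 0, which is never a
   bound when the mean is positive. *)
Definition hardy_bound (R : realType) (lam : R^nat) (M : weighted_mean R)
    (C : \bar R) : Prop :=
  forall x : R^nat, (forall n, 0 < x n) ->
  (\sum_(0 <= n <oo)
     (lam n * @M n.+1 (fun i => x i) (fun i => lam i))%:E
   <= C * \sum_(0 <= n <oo) (lam n * x n)%:E)%E.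

Definition is_hardy_constant (R : realType) (lam : R^nat)
    (M : weighted_mean R) (C : \bar R) : Prop :=
  hardy_bound lam M C /\
  forall C' : \bar R, hardy_bound lam M C' -> (C <= C')%E.

Definition C2_on_pos (R : realType) (f : R -> R) : Prop :=
  forall x : R, 0 < x ->
  [/\ derivable f x 1, derivable (f^`())%classic x 1 & {for x, continuous (f^`(2))%classic}].

Definition chi (R : realType) (f : R -> R) (x : R) : R :=
  x * (f^`(2))%classic x / (f^`())%classic x + 1.

Definition hardy_C (R : realType) (r eta : R) : R :=
  if eta == 0 then
    if r == 0 then expR 1 else (1 - r) `^ (- r^-1)
  else
    if r == 0 then (1 - eta) `^ (1 - eta^-1)
    else (eta / (1 - (1 - eta) `^ (1 - r))) `^ (r^-1).

(* Main.v *)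
Require Import Defs.
From HB Require Import structures.
From mathcomp Require Import all_boot all_order all_algebra.
From mathcomp Require Import all_classical all_reals all_analysis.
From mathcomp Require Import ring lra.
Set Implicit Arguments.
Unset Strict Implicit.
Unset Printing Implicit Defensive.
Import Order.TTheory GRing.Theory Num.Theory.
Import numFieldNormedType.Exports.
Local Open Scope ring_scope.
Local Open Scope classical_set_scope.

(* Replacing f by -f we may assume f' > 0. Let u(s) = (s^p - 1)/p (ln s if
   p = 0). Since chi_f <= p, f'(x) x^(1-p) is nonincreasing, hence
   f(ys) - f(y) <= y f'(y) u(s); near 0 the reverse inequality holds up to a
   factor close to 1. The constant C = C(p, eta) is the solution of
   eta u(1/C) + (1 - eta) u(1/(1 - eta)) = 0 (of u(1/C) = -1 if eta = 0), which
   is the only information on C that is used.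
   Upper bound: with G_n the n-th mean and a = C^p (1 - eta)^(1-p), the tangent
   lines of the concave function u at 1/(1 - eta) and 1/C give
   lambda_n G_n + a Lambda_n G_n - a Lambda_{n-1} G_{n-1} <= C lambda_n x_n
   whenever lambda_n/Lambda_n >= eta, and these inequalities telescope.
   Lower bound: if K < C and x_n = 1/(K Lambda_n) for n large, then
   G_n >= 1/Lambda_n propagates by induction, while the sum of
   lambda_n/Lambda_n diverges; so no constant below K is a bound. *)

(** * Mean value comparison and the concave function u *)

Lemma increment_le (R : realType) (g dg h dh : R -> R) (a b : R) : a <= b ->
  (forall x, a <= x <= b -> is_derive x 1 g (dg x)) ->
  (forall x, a <= x <= b -> is_derive x 1 h (dh x)) ->
  (forall x, a <= x <= b -> dg x <= dh x) ->
  g b - g a <= h b - h a.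
Proof.
move=> ab gE hE gh.
have kE x : a <= x <= b -> is_derive x 1 (h - g) (dh x - dg x).
  by move=> xab; have := gE _ xab; have := hE _ xab => ? ?; exact: is_deriveB.
have [||c cab] := @MVT_segment R (h - g) (fun x => dh x - dg x) a b ab.
- by move=> x; rewrite in_itv/= => /andP[ax xb]; apply: kE; rewrite !ltW.
- apply: derivable_within_continuous => x; rewrite in_itv/= => xab.
  by have [] := kE _ xab.
move: cab; rewrite in_itv/= => cab.
rewrite !fctE => E.
have : 0 <= (dh c - dg c) * (b - a).
  by apply: mulr_ge0; rewrite subr_ge0 // gh.
rewrite -E; lra.
Qed.

Lemma ler_powR_npos (R : realType) (q x y : R) :
  q <= 0 -> 0 < x -> x <= y -> y `^ q <= x `^ q.
Proof.
move=> q0 x0 xy; have y0 := lt_le_trans x0 xy.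
rewrite -[q]opprK (powRN y) (powRN x) lef_pV2 ?posrE ?powR_gt0//.
by apply: ge0_ler_powR; rewrite ?nnegrE ?oppr_ge0 //; exact: ltW.
Qed.

(** The function u: the primitive of x^(p - 1) on (0, oo) that vanishes at 1, also called the
    Box-Cox transform. *)
Definition box_cox (R : realType) (p x : R) : R :=
  if p == 0 then ln x else (x `^ p - 1) / p.

Lemma box_cox1 (R : realType) (p : R) : box_cox p 1 = 0.
Proof. by rewrite /box_cox ln1 powR1 subrr mul0r if_same. Qed.

Lemma is_derive_box_cox (R : realType) (p x : R) : 0 < x ->
  is_derive x 1 (box_cox p) (x `^ (p - 1)).
Proof.
move=> x0; have [->|p0] := eqVneq p 0.
  rewrite (_ : box_cox 0 = @ln R); last first.
    by apply/funext => z; rewrite /box_cox eqxx.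
  by rewrite sub0r powR_inv1 ?ltW//; exact: is_derive1_ln.
have dp := is_derive1_powR p x0.
rewrite (_ : box_cox p = p^-1 \*: ((@powR R ^~ p) - cst 1)); last first.
  by apply/funext => z; rewrite /box_cox (negbTE p0) mulrC.
apply: is_derive_eq; rewrite subr0 /GRing.scale/= mulrA mulVf//.
by rewrite mul1r.
Qed.

(** The derivative x^(p - 1) is nonincreasing since p <= 1, so between s and t it compares with its
    value at t: u is concave. *)
Lemma box_cox_tangent (R : realType) (p s t : R) : p <= 1 -> 0 < s -> 0 < t ->
  box_cox p s <= box_cox p t + t `^ (p - 1) * (s - t).
Proof.
move=> p1 s0 t0; have q0 : p - 1 <= 0 by lra.
have dl (x : R) : is_derive x 1 ( *%R (t `^ (p - 1))) (t `^ (p - 1)).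
  by apply: is_derive_eq; rewrite [_%:A]mulr1.
have db (x : R) : 0 < x -> is_derive x 1 (box_cox p) (x `^ (p - 1)).
  exact: is_derive_box_cox.
have [st|/ltW ts] := leP s t.
  have : t `^ (p - 1) * t - t `^ (p - 1) * s <= box_cox p t - box_cox p s.
    apply: (@increment_le R _ (fun=> t `^ (p - 1)) _ (fun x => x `^ (p - 1)))
      => // x /andP[sx xt]; first by apply: db; lra.
    by apply: ler_powR_npos => //; lra.
  lra.
have : box_cox p s - box_cox p t <= t `^ (p - 1) * s - t `^ (p - 1) * t.
  apply: (@increment_le R _ (fun x => x `^ (p - 1)) _ (fun=> t `^ (p - 1)))
    => // x /andP[tx xs]; first by apply: db; lra.
  by apply: ler_powR_npos => //; lra.
lra.
Qed.

Lemma box_cox_ltr (R : realType) (p s t : R) : p <= 1 -> 0 < s -> s < t ->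
  box_cox p s < box_cox p t.
Proof.
move=> p1 s0 st; have t0 : 0 < t by lra.
apply: le_lt_trans (box_cox_tangent p1 s0 t0) _.
rewrite gtrDl pmulr_rlt0 ?powR_gt0//; lra.
Qed.

(** * Comparison of f with power functions *)

(** Both derivatives are explicit parameters, so that the results apply to whichever of f and -f is
    increasing. *)
Definition smooth_increasing (R : realType) (f f1 f2 : R -> R) : Prop :=
  forall x : R, 0 < x ->
  [/\ is_derive x 1 f (f1 x), is_derive x 1 f1 (f2 x) & 0 < f1 x].

Lemma is_derive_mul_powR (R : realType) (f1 f2 : R -> R) (q x : R) : 0 < x ->
  is_derive x 1 f1 (f2 x) ->
  is_derive x 1 (fun x => f1 x * x `^ (1 - q))
    (x `^ (- q) * (x * f2 x - (q - 1) * f1 x)).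
Proof.
move=> x0 d1; have dp := is_derive1_powR (1 - q) x0.
have dm := is_deriveM d1 dp.
apply: is_derive_eq dm _.
rewrite /= !/(_ *: _)/= (_ : 1 - q - 1 = - q); last by ring.
rewrite (_ : x `^ (1 - q) = x `^ (- q) * x); first by ring.
rewrite addrC powRD; last by rewrite (gt_eqF x0) implybT.
by rewrite powRr1 ?ltW.
Qed.

(** The hypothesis, chi_f <= q on the segment, makes the derivative of f'(x) x^(1 - q) nonpositive;
    comparison with a constant function concludes. *)
Lemma derivative_growth_le (R : realType) (f f1 f2 : R -> R) (q a b : R) :
  smooth_increasing f f1 f2 -> 0 < a -> a <= b ->
  (forall x, a <= x <= b -> x * f2 x <= (q - 1) * f1 x) ->
  f1 b * b `^ (1 - q) <= f1 a * a `^ (1 - q).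
Proof.
move=> fs a0 ab H; set g := fun x => f1 x * x `^ (1 - q).
have dg (x : R) : a <= x <= b ->
    is_derive x 1 g (x `^ (- q) * (x * f2 x - (q - 1) * f1 x)).
  move=> /andP[ax xb]; apply: is_derive_mul_powR; first by lra.
  by have [|] := fs x; first by lra.
have dc (x : R) : a <= x <= b -> is_derive x 1 (cst (0 : R)) 0.
  by move=> _; exact: is_derive_cst.
have := increment_le ab dg dc.
rewrite /= subrr subr_le0 -/(g a); apply => x /andP[ax xb].
by rewrite pmulr_rle0 ?subr_le0 ?H ?ax// powR_gt0; lra.
Qed.

Lemma derivative_growth_ge (R : realType) (f f1 f2 : R -> R) (q a b : R) :
  smooth_increasing f f1 f2 -> 0 < a -> a <= b ->
  (forall x, a <= x <= b -> (q - 1) * f1 x <= x * f2 x) ->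
  f1 a * a `^ (1 - q) <= f1 b * b `^ (1 - q).
Proof.
move=> fs a0 ab H; set g := fun x => f1 x * x `^ (1 - q).
have dg (x : R) : a <= x <= b ->
    is_derive x 1 g (x `^ (- q) * (x * f2 x - (q - 1) * f1 x)).
  move=> /andP[ax xb]; apply: is_derive_mul_powR; first by lra.
  by have [|] := fs x; first by lra.
have dc (x : R) : a <= x <= b -> is_derive x 1 (cst (0 : R)) 0.
  by move=> _; exact: is_derive_cst.
have := increment_le ab dc dg.
rewrite /= subrr subr_ge0 -/(g a); apply => x /andP[ax xb].
by rewrite pmulr_rge0 ?subr_ge0 ?H ?ax// powR_gt0; lra.
Qed.

Lemma is_derive_scale (R : realType) (f f1 : R -> R) (y z : R) :
  is_derive (y * z) 1 f (f1 (y * z)) ->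
  is_derive z 1 (fun z => f (y * z)) (y * f1 (y * z)).
Proof.
move=> df; have dy : is_derive z 1 ( *%R y) y.
  by apply: is_derive_eq; rewrite [_%:A]mulr1.
by rewrite mulrC; exact: is_derive1_comp.
Qed.

Lemma is_derive_mulr_box_cox (R : realType) (k p z : R) : 0 < z ->
  is_derive z 1 (fun z => k * box_cox p z) (k * z `^ (p - 1)).
Proof.
move=> z0; have db := is_derive_box_cox p z0.
exact: (@is_deriveZ _ _ _ (box_cox p) k).
Qed.

(** Converts monotonicity of f'(x) x^(1 - q) between y and y z into a bound of f'(y z) by f'(y) z^(q
    - 1). *)
Lemma ler_powR_scale (R : realType) (q u v y z : R) : 0 < y -> 0 < z ->
  (u * (y * z) `^ (1 - q) <= v * y `^ (1 - q)) = (u <= v * z `^ (q - 1)).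
Proof.
move=> y0 z0; rewrite powRM ?(ltW y0) ?(ltW z0)// mulrCA mulrC ler_pM2r ?powR_gt0//.
by rewrite -ler_pdivlMr ?powR_gt0// -powRN opprB.
Qed.

Lemma ler_powR_scaler (R : realType) (q u v y z : R) : 0 < y -> 0 < z ->
  (v * y `^ (1 - q) <= u * (y * z) `^ (1 - q)) = (v * z `^ (q - 1) <= u).
Proof.
move=> y0 z0; rewrite powRM ?(ltW y0) ?(ltW z0)// [u * _]mulrCA [_ * (u * _)]mulrC.
rewrite ler_pM2r ?powR_gt0// -ler_pdivrMr ?powR_gt0// -powRN opprB.
by [].
Qed.

(** The derivative y f'(y z) of f(y z) in z is at most y f'(y) z^(p - 1) for z >= 1 and at least
    that for z <= 1. Integrating away from z = 1 bounds the increment from above in both cases. *)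
Lemma increment_le_box_cox (R : realType) (f f1 f2 : R -> R) (p y s : R) :
  smooth_increasing f f1 f2 ->
  (forall x : R, 0 < x -> x * f2 x <= (p - 1) * f1 x) ->
  0 < y -> 0 < s -> f (y * s) - f y <= y * f1 y * box_cox p s.
Proof.
move=> fs H y0 s0.
pose F (z : R) := f (y * z); pose dF (z : R) := y * f1 (y * z).
have df (z : R) : 0 < z -> is_derive z 1 F (dF z).
  move=> z0; apply: is_derive_scale.
  by have [|] := fs (y * z); first exact: mulr_gt0.
pose B (z : R) := y * f1 y * box_cox p z.
pose dB (z : R) := y * f1 y * z `^ (p - 1).
have db (z : R) : 0 < z -> is_derive z 1 B (dB z).
  exact: is_derive_mulr_box_cox.
have [s1|/ltW s1] := leP s 1.
  have : B 1 - B s <= F 1 - F s.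
    apply: (@increment_le R B dB F dF _ _ s1) => [x /andP[sx _]|x /andP[sx _]|x /andP[sx x1]].
    - by apply: db; lra.
    - by apply: df; lra.
    - rewrite /dB /dF -mulrA ler_pM2l// -(ler_powR_scaler _ _ _ y0)//; last by lra.
      apply: (derivative_growth_le fs); first by apply: mulr_gt0; lra.
        by rewrite ger_pMr.
      by move=> t /andP[yt _]; apply: H; apply: lt_le_trans yt; apply: mulr_gt0; lra.
  by rewrite /B /F box_cox1 mulr1; lra.
have : F s - F 1 <= B s - B 1.
  apply: (@increment_le R F dF B dB _ _ s1) => [x /andP[sx _]|x /andP[sx _]|x /andP[sx x1]].
  - by apply: df; lra.
  - by apply: db; lra.
  - rewrite /dB /dF -mulrA ler_pM2l// -(ler_powR_scale _ _ _ y0)//; last by lra.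
    apply: (derivative_growth_le fs) => //; first by rewrite ler_pMr.
    by move=> t /andP[yt _]; apply: H; lra.
by rewrite /B /F box_cox1 mulr1; lra.
Qed.

(** Near 0 the reverse comparison holds with exponent p - e only. The extra factor z^(-e) is at
    least S^(-e) on [1, S], so u keeps its exponent p at the price of a constant factor. *)
Lemma box_cox_le_increment (R : realType) (f f1 f2 : R -> R) (p e y s S : R) :
  smooth_increasing f f1 f2 -> 0 <= e -> 0 < y -> 1 <= s <= S ->
  (forall x : R, 0 < x <= y * S -> (p - e - 1) * f1 x <= x * f2 x) ->
  y * f1 y * S `^ (- e) * box_cox p s <= f (y * s) - f y.
Proof.
move=> fs e0 y0 /andP[s1 sS] H.
pose F (z : R) := f (y * z); pose dF (z : R) := y * f1 (y * z).
have df (z : R) : 0 < z -> is_derive z 1 F (dF z).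
  move=> z0; apply: is_derive_scale.
  by have [|] := fs (y * z); first exact: mulr_gt0.
pose B (z : R) := y * f1 y * S `^ (- e) * box_cox p z.
pose dB (z : R) := y * f1 y * S `^ (- e) * z `^ (p - 1).
have db (z : R) : 0 < z -> is_derive z 1 B (dB z).
  exact: is_derive_mulr_box_cox.
have [_ _ f1y] := fs _ y0.
have : B s - B 1 <= F s - F 1.
  apply: (@increment_le R B dB F dF _ _ s1) => [x /andP[sx _]|x /andP[sx _]|x /andP[x1 xs]].
  - by apply: db; lra.
  - by apply: df; lra.
  - have x0 : 0 < x by lra.
    rewrite /dB /dF -!mulrA ler_pM2l//.
    apply: (@le_trans _ _ (f1 y * x `^ (p - e - 1))).
      rewrite ler_pM2l// (_ : p - e - 1 = - e + (p - 1)); last by ring.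
      rewrite [x `^ (- e + _)]powRD; last by rewrite (gt_eqF x0) implybT.
      rewrite ler_pM2r ?powR_gt0//; apply: ler_powR_npos; lra.
    rewrite -(ler_powR_scaler _ _ _ y0)//; apply: (derivative_growth_ge fs) => //.
      by rewrite ler_pMr.
    move=> t /andP[yt tx]; apply: H; apply/andP; split; first by lra.
    by apply: le_trans tx _; rewrite ler_pM2l//; lra.
by rewrite /B /F box_cox1 mulr1; lra.
Qed.

(** On [t, 1] the extra factor z^(-e) is at most t^(-e). It multiplies the nonpositive number u(t),
    so the lower bound again loses only a constant factor. *)
Lemma box_cox_le_decrement (R : realType) (f f1 f2 : R -> R) (p e y t : R) :
  smooth_increasing f f1 f2 -> 0 <= e -> 0 < y -> 0 < t <= 1 ->
  (forall x : R, 0 < x <= y -> (p - e - 1) * f1 x <= x * f2 x) ->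
  y * f1 y * t `^ (- e) * box_cox p t <= f (y * t) - f y.
Proof.
move=> fs e0 y0 /andP[t0 t1] H.
pose F (z : R) := f (y * z); pose dF (z : R) := y * f1 (y * z).
have df (z : R) : 0 < z -> is_derive z 1 F (dF z).
  move=> z0; apply: is_derive_scale.
  by have [|] := fs (y * z); first exact: mulr_gt0.
pose B (z : R) := y * f1 y * t `^ (- e) * box_cox p z.
pose dB (z : R) := y * f1 y * t `^ (- e) * z `^ (p - 1).
have db (z : R) : 0 < z -> is_derive z 1 B (dB z).
  exact: is_derive_mulr_box_cox.
have [_ _ f1y] := fs _ y0.
have : F 1 - F t <= B 1 - B t.
  apply: (@increment_le R F dF B dB _ _ t1) => [x /andP[tx _]|x /andP[tx _]|x /andP[tx x1]].
  - by apply: df; lra.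
  - by apply: db; lra.
  - have x0 : 0 < x by lra.
    rewrite /dB /dF -!mulrA ler_pM2l//.
    apply: (@le_trans _ _ (f1 y * x `^ (p - e - 1))); last first.
      rewrite ler_pM2l// (_ : p - e - 1 = - e + (p - 1)); last by ring.
      rewrite [x `^ (- e + _)]powRD; last by rewrite (gt_eqF x0) implybT.
      rewrite ler_pM2r ?powR_gt0//; apply: ler_powR_npos; lra.
    rewrite -(ler_powR_scale _ _ _ y0)//; apply: (derivative_growth_ge fs).
    + by apply: mulr_gt0.
    + by rewrite ger_pMr.
    + move=> z /andP[yz zy]; apply: H; apply/andP; split; last by [].
      by apply: lt_le_trans yz; apply: mulr_gt0.
by rewrite /B /F box_cox1 mulr1; lra.
Qed.

(** * The constant C and the inequality behind the upper bound *)

Lemma powR_lt1 (R : realType) (x q : R) : 0 < x -> x < 1 -> 0 < q -> x `^ q < 1.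
Proof.
move=> x0 x1 q0; have <- : 1 `^ q = 1 :> R by rewrite powR1.
by apply: gt0_ltr_powR; rewrite // nnegrE ltW.
Qed.

Lemma hardy_C_gt0 (R : realType) (p eta : R) : p < 1 -> 0 <= eta < 1 ->
  0 < hardy_C p eta.
Proof.
move=> p1 /andP[eta0 eta1]; rewrite /hardy_C.
have [e0|en0] := eqVneq eta 0; have [p0|pn0] := eqVneq p 0.
- exact: expR_gt0.
- by apply: powR_gt0; lra.
- by apply: powR_gt0; lra.
- have ep : 0 < eta by rewrite lt0r en0.
  apply: powR_gt0; apply: divr_gt0 => //.
  by rewrite subr_gt0; apply: powR_lt1; lra.
Qed.

Lemma box_cox_hardy_C0 (R : realType) (p : R) : p < 1 ->
  box_cox p (hardy_C p 0)^-1 = -1.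
Proof.
move=> p1; rewrite /hardy_C eqxx /box_cox; have [p0|pn0] := eqVneq p 0.
  by rewrite lnV ?posrE ?expR_gt0// expRK.
rewrite -powRN opprK -powRrM mulVf// powRr1; last by lra.
by field.
Qed.

Lemma box_cox_hardy_C (R : realType) (p eta : R) : p < 1 -> 0 < eta < 1 ->
  eta * box_cox p (hardy_C p eta)^-1 + (1 - eta) * box_cox p (1 - eta)^-1 = 0.
Proof.
move=> p1 /andP[eta0 eta1]; have e0 : 0 < 1 - eta by lra.
have en0 : eta != 0 by rewrite gt_eqF.
rewrite /hardy_C (negbTE en0) /box_cox; have [p0|pn0] := eqVneq p 0.
  rewrite !lnV ?posrE ?powR_gt0// ln_powR; field.
  by [].
have d1 : (1 - eta) `^ (1 - p) < 1 by apply: powR_lt1; lra.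
have d2 : 0 < 1 - (1 - eta) `^ (1 - p) by lra.
set D := eta / _; have D0 : 0 <= D by apply: divr_ge0; lra.
have -> : ((D `^ p^-1)^-1) `^ p = D^-1.
  by rewrite -powRN -powRrM mulNr mulVf// powR_inv1.
have -> : (1 - eta)^-1 `^ p = (1 - eta) `^ (- p).
  by rewrite -powR_inv1 ?(ltW e0)// -powRrM mulN1r.
(* All powers are expressed through (1 - eta)^(-p), also in [d2], so that a rational identity with
   nonzero denominator remains. *)
rewrite /D; move: d2.
have -> : (1 - eta) `^ (1 - p) = (1 - eta) * (1 - eta) `^ (- p).
  by rewrite powRD ?powRr1 ?(ltW e0)// (gt_eqF e0) implybT.
move=> d2; field; rewrite pn0 en0 /=; lra.
Qed.

(** Since u increases and u(1) = 0, it suffices that u(1/C) < 0. The equation for C gives this: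
    u(1/C) = -1 if eta = 0, and otherwise u is positive at 1/(1 - eta) > 1. *)
Lemma hardy_C_gt1 (R : realType) (p eta : R) : p < 1 -> 0 <= eta < 1 ->
  1 < hardy_C p eta.
Proof.
move=> p1 /andP[e0 e1]; have C0 : 0 < hardy_C p eta by apply: hardy_C_gt0; lra.
suff : box_cox p (hardy_C p eta)^-1 < 0.
  apply: contraTT; rewrite -!leNgt => C1; rewrite -(box_cox1 p).
  have : 1 <= (hardy_C p eta)^-1 by rewrite invf_ge1.
  rewrite le_eqVlt => /predU1P[<-//|C1'].
  by apply/ltW/box_cox_ltr => //; lra.
have [e00|en0] := eqVneq eta 0; first by rewrite e00 box_cox_hardy_C0//; lra.
have ep : 0 < eta by rewrite lt0r en0.
have /(_ p1) := @box_cox_hardy_C R p eta; rewrite ep e1 => /(_ isT) H.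
have : box_cox p 1 < box_cox p (1 - eta)^-1.
  by apply: box_cox_ltr; rewrite ?invf_gt1; lra.
rewrite box_cox1 => u0.
rewrite -(pmulr_rlt0 _ ep).
have : 0 < (1 - eta) * box_cox p (1 - eta)^-1 by apply: mulr_gt0 => //; lra.
lra.
Qed.

(* Tangent lines of box_cox at (1 - eta)^-1 and C^-1 reduce the claim to the sign
   of a function linear in (L, l) that vanishes when eta * (L + l) = l and whose
   sign at l = 0 is known. *)
Lemma hardy_potential_step (R : realType) (p eta L l s t : R) :
  let C := hardy_C p eta in
  let a := C `^ p * (1 - eta)^-1 `^ (p - 1) in
  p < 1 -> 0 <= eta < 1 -> 0 <= L -> 0 <= l -> eta * (L + l) <= l ->
  0 < s -> 0 < t -> 0 <= L * box_cox p s + l * box_cox p t ->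
  a * (L + l) + l <= L * (a * s) + l * (C * t).
Proof.
move=> C a p1 /andP[e0 e1] L0 l0 Ll s0 t0 H.
have C0 : 0 < C by apply: hardy_C_gt0; lra.
have m0 : 0 < C `^ p by apply: powR_gt0.
have z0 : 0 < (1 - eta)^-1 by rewrite invr_gt0; lra.
have T1 w : 0 < w -> C `^ p * box_cox p w <=
    C `^ p * box_cox p (1 - eta)^-1 + a * (w - (1 - eta)^-1).
  move=> w0; rewrite /a -[C `^ p * _ * _]mulrA -mulrDr ler_pM2l//.
  by apply: box_cox_tangent => //; exact: ltW.
(* The factor C^p normalizes the slope of the tangent at 1/C to exactly C. *)
have T2 : C `^ p * box_cox p t <= C `^ p * box_cox p C^-1 + (C * t - 1).
  have -> : C * t - 1 = C `^ p * (C^-1 `^ (p - 1) * (t - C^-1)).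
    have -> : C^-1 `^ (p - 1) = C `^ (1 - p).
      by rewrite -powR_inv1 ?(ltW C0)// -powRrM mulN1r opprB.
    rewrite mulrA -powRD; last by rewrite (gt_eqF C0) implybT.
    by rewrite addrCA subrr addr0 powRr1 ?(ltW C0)// mulrBr divff ?gt_eqF.
  rewrite -mulrDr ler_pM2l//.
  by apply: box_cox_tangent; rewrite ?invr_gt0// ltW.
have T11 := T1 _ ltr01; rewrite box_cox1 mulr0 in T11.
have H1 := ler_wpM2l L0 (T1 _ s0); have H2 := ler_wpM2l l0 T2.
have H3 : 0 <= C `^ p * (L * box_cox p s + l * box_cox p t).
  by rewrite mulr_ge0// ltW.
suff K : L * (C `^ p * box_cox p (1 - eta)^-1 - a * (1 - eta)^-1 + a) +
    l * (C `^ p * box_cox p C^-1 + a) <= 0 by lra.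
have [e00|en0] := eqVneq eta 0.
  rewrite /a /C e00 box_cox_hardy_C0// subr0 invr1 powR1 box_cox1.
  by rewrite !mulr1 mulr0 sub0r mulrN1 !addNr !mulr0 addr0.
have ep : 0 < eta by rewrite lt0r en0.
have E : eta * box_cox p C^-1 = - (1 - eta) * box_cox p (1 - eta)^-1.
  have := @box_cox_hardy_C R p eta p1; rewrite ep e1 => /(_ isT); rewrite -/C; lra.
rewrite -(pmulr_rle0 _ ep) mulrDr.
rewrite [X in _ + X](_ : _ = l * (C `^ p * (eta * box_cox p C^-1) + eta * a)); last by ring.
(* After multiplication by eta, the left side of [K] is the negative of this product; its second
   factor is nonnegative by [T11]. *)
rewrite E; have : 0 <= (l - eta * (L + l)) * (a - a * (1 - eta)^-1 +
    C `^ p * box_cox p (1 - eta)^-1) by apply: mulr_ge0; lra.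
rewrite -oppr_le0; apply: eq_rect; congr (_ <= _); field; lra.
Qed.

(** * Sequences of weighted means and the upper bound *)

Lemma partial_weightS (R : realType) (lam : R^nat) n :
  partial_weight lam n.+1 = partial_weight lam n + lam n.+1.
Proof. by rewrite /partial_weight big_ord_recr. Qed.

Lemma partial_weight_gt0 (R : realType) (lam : R^nat) n :
  W0 lam -> 0 < partial_weight lam n.
Proof.
move=> [l0 l]; elim: n => [|n IH]; first by rewrite /partial_weight big_ord1.
by rewrite partial_weightS ltr_wpDr.
Qed.

(** The means are given by their defining equation instead of an inverse of f; this equation is
    unaffected by replacing f with -f. *)
Definition mean_seq (R : realType) (f : R -> R) (lam x G : R^nat) : Prop :=
  forall n, 0 < G n /\
    f (G n) * partial_weight lam n = \sum_(k < n.+1) lam k * f (x k).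

(** Each mean is a two-point mean of the previous mean and the new term; the inductions for both
    bounds run on this recursion. *)
Lemma mean_seqS (R : realType) (f : R -> R) (lam x G : R^nat) n :
  mean_seq f lam x G ->
  f (G n.+1) * (partial_weight lam n + lam n.+1) =
  f (G n) * partial_weight lam n + lam n.+1 * f (x n.+1).
Proof.
move=> GE; have [_] := GE n.+1.
by rewrite partial_weightS big_ord_recr/= => ->; have [_ ->] := GE n.
Qed.

(** With base point G, compare f at g = G s and x = G t. The mean equation cancels f(G) and leaves L
    u(s) + l u(t) >= 0, which is what [hardy_potential_step] requires. *)
Lemma mean_seq_potential (R : realType) (f f1 f2 : R -> R) (p eta L l g x G : R) :
  let C := hardy_C p eta in
  let a := C `^ p * (1 - eta)^-1 `^ (p - 1) in
  smooth_increasing f f1 f2 ->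
  (forall x : R, 0 < x -> x * f2 x <= (p - 1) * f1 x) ->
  p < 1 -> 0 <= eta < 1 -> 0 <= L -> 0 <= l -> eta * (L + l) <= l ->
  0 < g -> 0 < x -> 0 < G -> f G * (L + l) = f g * L + l * f x ->
  l * G + a * (L + l) * G <= a * L * g + C * (l * x).
Proof.
move=> C a fs H p1 e01 L0 l0 Ll g0 x0 G0 GE.
have [_ _ f1G] := fs _ G0.
have gG : 0 < g / G by rewrite divr_gt0.
have xG : 0 < x / G by rewrite divr_gt0.
have := increment_le_box_cox fs H G0 gG; have := increment_le_box_cox fs H G0 xG.
have -> : G * (x / G) = x by field; rewrite gt_eqF.
have -> : G * (g / G) = g by field; rewrite gt_eqF.
move=> /(ler_wpM2l l0) ix /(ler_wpM2l L0) ig.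
have : 0 <= L * box_cox p (g / G) + l * box_cox p (x / G).
  have k0 : 0 < G * f1 G by rewrite mulr_gt0.
  rewrite -(pmulr_rge0 _ k0); lra.
move=> /(hardy_potential_step p1 e01 L0 l0 Ll gG xG).
rewrite -/C -/a -(ler_pM2l G0).
rewrite [leRHS](_ : _ = a * L * g + C * (l * x)); first lra.
by field; rewrite gt_eqF.
Qed.

Lemma mean_seq_hardy (R : realType) (f f1 f2 : R -> R) (p eta : R)
    (lam x G : R^nat) N :
  smooth_increasing f f1 f2 ->
  (forall x : R, 0 < x -> x * f2 x <= (p - 1) * f1 x) ->
  p < 1 -> 0 <= eta < 1 -> W0 lam ->
  (forall n, eta * partial_weight lam n <= lam n) ->
  (forall n, 0 < x n) -> mean_seq f lam x G ->
  \sum_(k < N) lam k * G k <= hardy_C p eta * \sum_(k < N) lam k * x k.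
Proof.
move=> fs H p1 e01 lW el x0 GE.
case: N => [|N]; first by rewrite !big_ord0 mulr0.
set C := hardy_C p eta; set a := C `^ p * (1 - eta)^-1 `^ (p - 1).
have a0 : 0 <= a by rewrite mulr_ge0// powR_ge0.
(* The induction carries the potential a Lambda_N G_N, which is nonnegative and dropped at the
   end. *)
suff : \sum_(k < N.+1) lam k * G k + a * partial_weight lam N * G N <=
    C * \sum_(k < N.+1) lam k * x k.
  apply: le_trans; rewrite lerDl; apply: mulr_ge0.
    exact: mulr_ge0 a0 (ltW (partial_weight_gt0 _ lW)).
  by have [/ltW] := GE N.
have lam0 n : 0 <= lam n by case: lW.
elim: N => [|N IH].
  have [G0 E0] := GE 0%N; rewrite /partial_weight !big_ord1 in E0 *.
  have e0 := el 0%N; rewrite /partial_weight big_ord1 in e0.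
  (* At the first index there is no past: its weight L is 0, and [x 0%N] merely fills the slot of
     the previous mean. *)
  have := @mean_seq_potential R f f1 f2 p eta 0 (lam 0%N) (x 0%N) (x 0%N) (G 0%N).
  rewrite /= -/C -/a !(add0r, mulr0, mul0r) => P; apply: (P fs) => //.
rewrite !(@big_ord_recr _ _ _ N.+1)/= partial_weightS.
have := @mean_seq_potential R f f1 f2 p eta (partial_weight lam N) (lam N.+1)
  (G N) (x N.+1) (G N.+1) fs H p1 e01 _ (lam0 _).
rewrite -/C -/a => /(_ _ _ _ _ _ _)P.
have : lam N.+1 * G N.+1 + a * (partial_weight lam N + lam N.+1) * G N.+1 <=
  a * partial_weight lam N * G N + C * (lam N.+1 * x N.+1).
  apply: P.
  - by rewrite ltW ?partial_weight_gt0.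
  - by rewrite -partial_weightS.
  - by have [] := GE N.
  - by [].
  - by have [] := GE N.+1.
  - exact: mean_seqS GE.
lra.
Qed.

(** * Existence of the means *)

(** The required value of f lies between f(g) and f(x), so the intermediate value theorem on the
    segment joining g and x applies. *)
Lemma mean_exists (R : realType) (f f1 f2 : R -> R) (g x L l : R) :
  smooth_increasing f f1 f2 -> 0 < g -> 0 < x -> 0 < L -> 0 <= l ->
  exists G, 0 < G /\ f G * (L + l) = f g * L + l * f x.
Proof.
move=> fs g0 x0 L0 l0; have Ll : 0 < L + l by lra.
have cont (a b : R) : 0 < a -> {within `[a, b], continuous f}.
  move=> a0; apply: derivable_within_continuous => z; rewrite in_itv/= => /andP[az _].
  by have [|[]] := fs z; first exact: lt_le_trans az.
have wl (u v : R) : (u <= v) ->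
  u <= (u * L + l * v) / (L + l) <= v /\ u <= (v * L + l * u) / (L + l) <= v.
  move=> uv; rewrite !ler_pdivlMr// !ler_pdivrMr//.
  by split; apply/andP; split; nra.
suff [G G0 E] : exists2 G, 0 < G & f G = (f g * L + l * f x) / (L + l).
  by exists G; split => //; rewrite E divfK// gt_eqF.
have W : Num.min (f g) (f x) <= (f g * L + l * f x) / (L + l)
    <= Num.max (f g) (f x).
  by have [fgx|/ltW fgx] := leP (f g) (f x); [case: (wl _ _ fgx)|case: (wl _ _ fgx)].
have [gx|/ltW gx] := leP g x.
  have [G] := IVT gx (cont g x g0) W.
  by rewrite in_itv/= => /andP[gG _] E; exists G => //; exact: lt_le_trans gG.
rewrite minC maxC in W.
have [G] := IVT gx (cont x g x0) W.
by rewrite in_itv/= => /andP[gG _] E; exists G => //; exact: lt_le_trans gG.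
Qed.

Lemma mean_seq_exists (R : realType) (f f1 f2 : R -> R) (lam x : R^nat) :
  smooth_increasing f f1 f2 -> W0 lam -> (forall n, 0 < x n) ->
  forall n, exists G, 0 < G /\
    f G * partial_weight lam n = \sum_(k < n.+1) lam k * f (x k).
Proof.
move=> fs lW x0; elim=> [|n [G [G0 E]]].
  by exists (x 0%N); rewrite /partial_weight !big_ord1 mulrC.
rewrite partial_weightS big_ord_recr/= -E.
apply: (mean_exists fs) => //; first exact: partial_weight_gt0.
by case: lW.
Qed.

Lemma smooth_increasing_lt (R : realType) (f f1 f2 : R -> R) (y z : R) :
  smooth_increasing f f1 f2 -> 0 < y -> y < z -> f y < f z.
Proof.
move=> fs y0 yz.
have d (x : R) : y <= x -> is_derive x 1 f (f1 x).
  by move=> yx; have [|] := fs x; first exact: lt_le_trans yx.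
have [||c] := @MVT R f f1 y z yz.
- by move=> x; rewrite in_itv/= => /andP[/ltW yx _]; exact: d.
- apply: derivable_within_continuous => x; rewrite in_itv/= => /andP[yx _].
  by have [] := d _ yx.
rewrite in_itv/= => /andP[yc _] E; rewrite -subr_gt0 E mulr_gt0 ?subr_gt0//.
by have [|] := fs c; first exact: lt_trans yc.
Qed.

Lemma smooth_increasing_le (R : realType) (f f1 f2 : R -> R) (y z : R) :
  smooth_increasing f f1 f2 -> 0 < y -> y <= z -> f y <= f z.
Proof.
move=> fs y0; rewrite le_eqVlt => /predU1P[->//|yz].
exact/ltW/(smooth_increasing_lt fs).
Qed.

(** * The lower bound *)

(** One zero weight would make all later ratios vanish, and the partial weights would stay
    bounded. *)
Lemma weights_gt0 (R : realType) (lam : R^nat) :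
  W0 lam -> partial_weight lam n @[n --> \oo] --> +oo ->
  nonincreasing_seq (fun n => lam n / partial_weight lam n) ->
  forall n, 0 < lam n.
Proof.
move=> lW Loo ni m; have [_ l0] := lW.
rewrite lt0r l0 andbT; apply/negP => /eqP lm0.
have z n : (m <= n)%N -> lam n = 0.
  move=> mn; have := ni _ _ mn; rewrite lm0 mul0r ler_pdivrMr ?partial_weight_gt0//.
  by rewrite mul0r => ln0; apply/eqP; rewrite eq_le ln0 l0.
have cst n : partial_weight lam (m + n) = partial_weight lam m.
  elim: n => [|n IH]; first by rewrite addn0.
  by rewrite addnS partial_weightS IH z ?addr0// -addnS leq_addr.
move/cvgryPgt : Loo => /(_ (partial_weight lam m))[N _] /(_ (m + N)%N).
by rewrite /= cst ltxx leq_addl => /(_ isT).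
Qed.

Lemma cvg_powR (R : realType) (q a : R) (u : R^nat) : 0 < a ->
  u n @[n --> \oo] --> a -> (u n) `^ q @[n --> \oo] --> a `^ q.
Proof.
move=> a0 ua; suff c : {for a, continuous (@powR R ^~ q)}.
  exact: (continuous_cvg _ c ua).
apply/differentiable_continuous/derivable1_diffP.
by have [] := is_derive1_powR q a0.
Qed.

Lemma cvg_box_cox (R : realType) (p a : R) (u : R^nat) : 0 < a ->
  u n @[n --> \oo] --> a -> box_cox p (u n) @[n --> \oo] --> box_cox p a.
Proof.
move=> a0 ua; suff c : {for a, continuous (box_cox p)}.
  exact: (continuous_cvg _ c ua).
apply/differentiable_continuous/derivable1_diffP.
by have [] := is_derive_box_cox p a0.
Qed.

(** If eta > 0, the equation for C says that -u(1/C) is the slope of the chord of u from 1 to 1/(1 -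
    eta), and w is smaller. If eta = 0, both sides tend to 0; instead the tangent at [s n] has slope
    tending to 1 = -u(1/C) > w. *)
Lemma box_cox_slope_near (R : realType) (p eta w : R) (s : R^nat) :
  p < 1 -> 0 <= eta < 1 -> w < - box_cox p (hardy_C p eta)^-1 ->
  (forall n, 1 <= s n) -> s n @[n --> \oo] --> (1 - eta)^-1 ->
  \forall n \near \oo, w * (s n - 1) <= box_cox p (s n).
Proof.
move=> p1 /andP[e0 e1] wC s1 sl; have [e00|en0] := eqVneq eta 0.
  rewrite e00 box_cox_hardy_C0// opprK in wC.
  rewrite e00 subr0 invr1 in sl.
  have := cvg_powR (q := p - 1) ltr01 sl; rewrite powR1 => /cvgr_gt /(_ _ wC).
  apply: filterS => n ws.
  have sn := s1 n.
  have := @box_cox_tangent R p 1 (s n) (ltW p1) ltr01 _; rewrite box_cox1 => /(_ _)T.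
  have : w * (s n - 1) <= s n `^ (p - 1) * (s n - 1).
    by apply: ler_wpM2r; lra.
  have : 0 <= box_cox p (s n) + s n `^ (p - 1) * (1 - s n) by apply: T; lra.
  lra.
have ep : 0 < eta by rewrite lt0r en0.
have z0 : 0 < (1 - eta)^-1 by rewrite invr_gt0; lra.
have lim : box_cox p (s n) - w * (s n - 1) @[n --> \oo] -->
    box_cox p (1 - eta)^-1 - w * ((1 - eta)^-1 - 1).
  apply: cvgB; first exact: cvg_box_cox.
  by apply: cvgM; [exact: cvg_cst|apply: cvgB => //; exact: cvg_cst].
have pos : 0 < box_cox p (1 - eta)^-1 - w * ((1 - eta)^-1 - 1).
  have := @box_cox_hardy_C R p eta p1; rewrite ep e1 => /(_ isT) E.
  have -> : (1 - eta)^-1 - 1 = eta / (1 - eta) by field; lra.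
  have -> : box_cox p (1 - eta)^-1 =
     - (eta / (1 - eta)) * box_cox p (hardy_C p eta)^-1.
    have -> : box_cox p (1 - eta)^-1 = ((1 - eta) * box_cox p (1 - eta)^-1) / (1 - eta).
      by field; lra.
    have -> : (1 - eta) * box_cox p (1 - eta)^-1 = - (eta * box_cox p (hardy_C p eta)^-1).
      by lra.
    by field; lra.
  have : 0 < eta / (1 - eta) by apply: divr_gt0; lra.
  move=> q0; rewrite mulNr -mulrN [w * _]mulrC -mulrBr; apply: mulr_gt0 => //; lra.
by move/cvgr_gt : lim => /(_ _ pos); apply: filterS => n; lra.
Qed.

(** The gap between v and w absorbs the factors lost near 0: e is the solution of (S/t)^e = w/v,
    which gives equality. *)
Lemma exists_small_exponent (R : realType) (S t v w : R) :
  1 <= S -> 0 < t < 1 -> 0 < v < w ->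
  exists2 e : R, 0 < e & t `^ (- e) * v <= S `^ (- e) * w.
Proof.
move=> S1 /andP[t0 t1] /andP[v0 vw].
have S0 : 0 < S by lra.
have St1 : 1 < S / t by rewrite ltr_pdivlMr//; lra.
have r1 : 1 < w / v by rewrite ltr_pdivlMr// mul1r.
have St0 : 0 < ln (S / t) by rewrite ln_gt0.
exists (ln (w / v) / ln (S / t)); first by rewrite divr_gt0// ln_gt0.
set e := ln (w / v) / _.
have E : (S / t) `^ e = w / v.
  rewrite /powR gt_eqF; last by lra.
  by rewrite /e divfK ?gt_eqF// lnK ?posrE; lra.
have -> : t `^ (- e) = S `^ (- e) * (w / v).
  rewrite -E !powRN powRM ?(ltW S0) ?invr_ge0 ?(ltW t0)//.
  rewrite mulrA mulVf ?mul1r ?gt_eqF ?powR_gt0//.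
  by rewrite -[t^-1]powR_inv1 ?(ltW t0)// -powRrM mulN1r powRN.
by rewrite -mulrA divfK ?gt_eqF.
Qed.

(* Here (L + l)^-1 plays the role of y: the values of the extremal sequence at
   two consecutive indices are y and y * ((L + l) / L). *)
Lemma mean_lower_step (R : realType) (f f1 f2 : R -> R) (p e S t w L l g G : R) :
  smooth_increasing f f1 f2 -> 0 <= e -> 0 < t <= 1 ->
  - (t `^ (- e) * box_cox p t) <= S `^ (- e) * w ->
  0 < L -> 0 <= l -> (L + l) / L <= S ->
  w * ((L + l) / L - 1) <= box_cox p ((L + l) / L) ->
  (forall x : R, 0 < x <= (L + l)^-1 * S -> (p - e - 1) * f1 x <= x * f2 x) ->
  0 < G -> L^-1 <= g ->
  f G * (L + l) = f g * L + l * f (t / (L + l)) ->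
  (L + l)^-1 <= G.
Proof.
move=> fs e0 /andP[t0 t1] tw L0 l0 sS ws H G0 Lg GE.
have Ll0 : 0 < L + l by lra.
set y := (L + l)^-1; have y0 : 0 < y by rewrite invr_gt0.
set s := (L + l) / L; have s1 : 1 <= s by rewrite ler_pdivlMr//; lra.
have S1 : 1 <= S := le_trans s1 sS. have S0 : 0 < S := lt_le_trans ltr01 S1.
have [_ _ f1y] := fs _ y0.
have Hs : y * f1 y * S `^ (- e) * box_cox p s <= f (y * s) - f y.
  by apply: (box_cox_le_increment fs) => //; apply/andP.
have Ht : y * f1 y * t `^ (- e) * box_cox p t <= f (y * t) - f y.
  apply: (box_cox_le_decrement fs) => //; first exact/andP.
  move=> x /andP[x0 xy]; apply: H; apply/andP; split => //.
  by apply: le_trans xy _; rewrite ler_pMr.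
have sg : f (y * s) <= f g.
  have -> : y * s = L^-1 by rewrite /y /s mulrA mulVf ?mul1r// gt_eqF.
  by apply: (smooth_increasing_le fs) => //; rewrite invr_gt0.
rewrite leNgt; apply/negP => Gy.
have : f G * (L + l) < f y * (L + l).
  by rewrite ltr_pM2r//; exact: (smooth_increasing_lt fs).
rewrite GE (_ : t / (L + l) = y * t); last by rewrite mulrC.
have I1 := ler_wpM2l (ltW L0) Hs; have I2 := ler_wpM2l l0 Ht.
have I3 := ler_wpM2l (ltW L0) sg.
(* This turns the slope hypothesis into L u(s) >= w l, which outweighs the negative term l u(t) even
   with the factors S^(-e) and t^(-e). *)
have E : L * (s - 1) = l by rewrite /s; field; rewrite gt_eqF.
have : 0 <= y * f1 y * (S `^ (- e) * (L * box_cox p s) + l * (t `^ (- e) * box_cox p t)).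
  apply: mulr_ge0; first by rewrite mulr_ge0// ltW.
  have : S `^ (- e) * (w * l) <= S `^ (- e) * (L * box_cox p s).
    by rewrite ler_pM2l ?powR_gt0// -E mulrCA ler_pM2l//.
  have := ler_wpM2l l0 tw; lra.
lra.
Qed.

(** From ln(1 + z) <= z with z = L_(n+1)/L_n - 1; the bound S on the ratios pays for replacing the
    denominator L_n by L_(n+1). This makes the divergence of the sum of lambda_n/Lambda_n
    quantitative. *)
Lemma ratio_sum_ge_ln (R : realType) (L : R^nat) (S : R) n0 M :
  (forall n, 0 < L n) -> (forall n, L n <= L n.+1) ->
  (forall n, L n.+1 / L n <= S) ->
  ln (L (n0 + M)%N) - ln (L n0) <=
  S * \sum_(i < M) (L (n0 + i).+1 - L (n0 + i)%N) / L (n0 + i).+1.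
Proof.
move=> L0 Li LS; elim: M => [|M IH]; first by rewrite addn0 big_ord0 mulr0 subrr.
rewrite big_ord_recr/= mulrDr addnS.
set n := (n0 + M)%N in IH *.
suff : ln (L n.+1) - ln (L n) <= S * ((L n.+1 - L n) / L n.+1) by lra.
rewrite -ln_div ?posrE//.
have h : L n.+1 / L n - 1 <= S * ((L n.+1 - L n) / L n.+1).
  have -> : L n.+1 / L n - 1 = L n.+1 / L n * ((L n.+1 - L n) / L n.+1).
    by field; rewrite !gt_eqF.
  by apply: ler_wpM2r => //; rewrite divr_ge0 ?subr_ge0// ltW.
apply: le_trans h.
have /(le_ln1Dx (x := L n.+1 / L n - 1)) : -1 < L n.+1 / L n - 1.
  by rewrite ltrBrDl subrr divr_gt0.
by rewrite addrCA subrr addr0.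
Qed.

Lemma sum_geometric_half_le (R : realType) j :
  \sum_(i < j) (2^-1 : R) ^+ i.+1 <= 1.
Proof.
suff -> : \sum_(i < j) (2^-1 : R) ^+ i.+1 = 1 - 2^-1 ^+ j.
  by rewrite gerBl exprn_ge0// invr_ge0.
elim: j => [|j IH]; first by rewrite big_ord0 expr0 subrr.
by rewrite big_ord_recr/= IH exprS; lra.
Qed.

(* The sequence has to be summable; the geometric tail after n0 + M contributes at
   most 1, and the constant initial segment contributes exactly 1. *)
Lemma test_sequence_exists (R : realType) (lam : R^nat) (t : R) n0 M :
  (forall n, 0 < lam n) -> 0 < t ->
  exists x : R^nat, [/\ forall n, 0 < x n,
    forall n, (n <= n0)%N -> x n = (partial_weight lam n0)^-1,
    forall i, (i < M)%N -> x (n0 + i).+1 = t / partial_weight lam (n0 + i).+1 &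
    forall m, \sum_(k < m) lam k * x k <=
      2 + t * \sum_(i < M) lam (n0 + i).+1 / partial_weight lam (n0 + i).+1].
Proof.
move=> l0 t0.
have L0 n : 0 < partial_weight lam n.
  by apply: partial_weight_gt0; split=> // m; exact: ltW.
pose x k := if (k <= n0)%N then (partial_weight lam n0)^-1
  else if (k <= n0 + M)%N then t / partial_weight lam k
  else 2^-1 ^+ (k - (n0 + M)) / lam k.
have x0 n : 0 < x n.
  rewrite /x; case: ifP => _; first by rewrite invr_gt0.
  by case: ifP => _; rewrite divr_gt0// exprn_gt0// invr_gt0.
have xi i : (i < M)%N -> x (n0 + i).+1 = t / partial_weight lam (n0 + i).+1.
  by move=> iM; rewrite /x ltnNge leq_addr/= -addnS leq_add2l iM.
exists x; split => // [n nn0|m]; first by rewrite /x nn0.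
(* Lengthening the sum makes it split exactly into the constant, middle and geometric blocks. *)
have mono d : \sum_(k < m) lam k * x k <= \sum_(k < d + m) lam k * x k.
  elim: d => [//|d IH]; rewrite addSn big_ord_recr/=.
  by apply: le_trans IH _; rewrite lerDl mulr_ge0// ltW.
apply: le_trans (mono (n0.+1 + M)%N) _; rewrite !big_split_ord/=.
have -> : \sum_(i < n0.+1) lam i * x i = 1.
  rewrite -(divff (lt0r_neq0 (L0 n0))) {1}/partial_weight mulr_suml.
  by apply: eq_bigr => i _; rewrite /x -ltnS ltn_ord.
have -> : \sum_(i < M) lam (n0.+1 + i)%N * x (n0.+1 + i)%N =
    t * \sum_(i < M) lam (n0 + i).+1 / partial_weight lam (n0 + i).+1.
  by rewrite mulr_sumr; apply: eq_bigr => i _; rewrite addSn xi// mulrCA.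
have -> : \sum_(i < m) lam (n0.+1 + M + i)%N * x (n0.+1 + M + i)%N =
    \sum_(i < m) (2^-1 : R) ^+ i.+1.
  apply: eq_bigr => i _; rewrite /x !addSn.
  have -> : ((n0 + M + i).+1 <= n0)%N = false.
    by apply/negbTE; rewrite -ltnNge ltnS -addnA leq_addr.
  have -> : ((n0 + M + i).+1 <= n0 + M)%N = false.
    by apply/negbTE; rewrite -ltnNge ltnS leq_addr.
  by rewrite -addnS addKn mulrC divfK// gt_eqF.
have := sum_geometric_half_le R m; lra.
Qed.

Lemma hardy_constant_lower (R : realType) (f f1 f2 : R -> R) (p eta c : R)
    (lam : R^nat) :
  smooth_increasing f f1 f2 -> p < 1 -> 0 <= eta < 1 -> W0 lam ->
  partial_weight lam n @[n --> \oo] --> +oo ->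
  nonincreasing_seq (fun n => lam n / partial_weight lam n) ->
  lam n / partial_weight lam n @[n --> \oo] --> eta ->
  (forall e : R, 0 < e -> exists2 b : R, 0 < b &
    forall x, 0 < x <= b -> (p - e - 1) * f1 x <= x * f2 x) ->
  1 <= c ->
  (forall x : R^nat, (forall n, 0 < x n) -> exists2 G, mean_seq f lam x G &
    forall B, (forall m, \sum_(k < m) lam k * x k <= B) ->
    forall N, \sum_(k < N) lam k * G k <= c * B) ->
  hardy_C p eta <= c.
Proof.
move=> fs p1 e01 lW Loo ni rl chi_ge c1 H.
have l0 := weights_gt0 lW Loo ni.
have L0 n : 0 < partial_weight lam n by apply: partial_weight_gt0.
rewrite leNgt; apply/negP => cC.
set C := hardy_C p eta in cC *.
(* Room on both sides: K < C gives u(1/K) > u(1/C), hence a choice of w, and c < K gives c t < 1. *)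
have [K cK KC] : exists2 K, c < K & K < C.
  by exists ((c + C) / 2); lra.
have K0 : 0 < K by lra.
set t := K^-1; have t0 : 0 < t by rewrite invr_gt0.
have t1 : t < 1 by rewrite invf_lt1//; lra.
have ut0 : box_cox p t < 0 by rewrite -(box_cox1 p); apply: box_cox_ltr => //; lra.
have utC : box_cox p C^-1 < box_cox p t.
  apply: box_cox_ltr; rewrite ?invr_gt0 ?ltf_pV2 ?posrE//; lra.
have [w uw wC] : exists2 w, - box_cox p t < w & w < - box_cox p C^-1.
  by exists ((- box_cox p t - box_cox p C^-1) / 2); lra.
pose s n := partial_weight lam n.+1 / partial_weight lam n.
have sE n : s n = (1 - lam n.+1 / partial_weight lam n.+1)^-1.
  have := L0 n.+1; rewrite /s partial_weightS => Ln1; field.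
  by rewrite addrK !gt_eqF.
have s1 n : 1 <= s n.
  by rewrite ler_pdivlMr// mul1r partial_weightS lerDl ltW.
have r1 n : lam n.+1 / partial_weight lam n.+1 < 1.
  by rewrite ltr_pdivrMr// mul1r partial_weightS ltrDr.
have sl : s n @[n --> \oo] --> (1 - eta)^-1.
  rewrite (_ : s = fun n => (1 - lam n.+1 / partial_weight lam n.+1)^-1); last first.
    exact/funext.
  apply: cvgV; first by rewrite gt_eqF// subr_gt0; case/andP: e01.
  apply: cvgB; first exact: cvg_cst.
  by rewrite (cvg_shiftS (fun n => lam n / partial_weight lam n)).
(* Monotone ratios make [s 0%N] a uniform bound, used as S below. *)
have sS n : s n <= s 0%N.
  rewrite !sE lef_pV2 ?posrE ?subr_gt0// lerB//.
  exact: ni.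
have vw : 0 < - box_cox p t < w by apply/andP; split => //; lra.
have [|e e0 etw] := @exists_small_exponent R (s 0%N) t (- box_cox p t) w (s1 0%N) _ vw.
  by rewrite t0 t1.
have [b b0 Hb] := chi_ge e e0.
have slope := box_cox_slope_near p1 e01 wC s1 sl.
(* Places S/Lambda_n inside (0, b], where chi_f >= p - e. *)
have small : \forall n \near \oo, s 0%N / b <= partial_weight lam n.
  by move/cvgryPge : Loo => /(_ (s 0%N / b)).
have [n0 _ near0] := filterI slope small.
pose D M := \sum_(i < M) lam (n0 + i).+1 / partial_weight lam (n0 + i).+1.
(* The means at the M indices after n0 are at least 1/Lambda_n, so [D M] is below the sum of the
   lambda_n G_n. As c t < 1, this bounds [D M] uniformly in M. *)
have DB M : D M <= c * (2 + t * D M).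
  have [x [x0 xl xm xB]] := test_sequence_exists n0 M l0 t0.
  have [G GE GB] := H x x0.
  have := GB _ xB (n0.+1 + M)%N; apply: le_trans.
  have GL i : (i <= M)%N -> (partial_weight lam (n0 + i))^-1 <= G (n0 + i)%N.
    elim: i => [_|i IH iM].
      (* The terms up to n0 are all equal to 1/Lambda_n0, so f takes the same value at their
         mean. *)
      rewrite addn0 leNgt; apply/negP => Gx.
      have [G0 E] := GE n0.
      have := smooth_increasing_lt fs G0 Gx; rewrite -(ltr_pM2r (L0 n0)) E.
      have -> : \sum_(k < n0.+1) lam k * f (x k) =
          f ((partial_weight lam n0)^-1) * partial_weight lam n0.
        rewrite [X in _ = _ * X]/partial_weight mulr_sumr; apply: eq_bigr => k _.
        have kn : (k <= n0)%N by rewrite -ltnS ltn_ord.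
        rewrite mulrC.
        by rewrite (xl _ kn).
      by rewrite ltxx.
    rewrite addnS partial_weightS.
    have /near0[/= sl_i _] : (n0 <= n0 + i)%N by rewrite leq_addr.
    have /near0[/= _ sm_i] : (n0 <= (n0 + i).+1)%N by rewrite leqW ?leq_addr.
    apply: (@mean_lower_step R f f1 f2 p e (s 0%N) t w _ _ (G (n0 + i)%N)) => //.
    - exact: ltW.
    - by rewrite t0 ltW.
    - by rewrite -mulrN.
    - exact: ltW.
    - by rewrite -partial_weightS; exact: sS.
    - by rewrite -partial_weightS.
    - move=> z /andP[z0 zL]; apply: Hb; rewrite z0 (le_trans zL)//.
      rewrite -partial_weightS mulrC ler_pdivrMr// mulrC -ler_pdivrMr//.
    - by have [] := GE (n0 + i).+1.
    - by apply: IH; exact: ltnW.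
    - by rewrite (mean_seqS _ GE) xm// -partial_weightS.
  rewrite big_split_ord/= ler_wpDl//.
    apply: sumr_ge0 => i _; apply: mulr_ge0; first exact: ltW.
    by have [/ltW] := GE i.
  apply: ler_sum => i _; rewrite addSn ler_pM2l// -addnS.
  exact: GL.
have ct : c * t < 1 by rewrite /t ltr_pdivrMr// mul1r.
have ct0 : 0 < 1 - c * t by lra.
have Sg0 : 0 < s 0%N by have := s1 0%N; lra.
have Lbound M : ln (partial_weight lam (n0 + M)) <=
    ln (partial_weight lam n0) + s 0%N * (2 * c / (1 - c * t)).
  have h : ln (partial_weight lam (n0 + M)) - ln (partial_weight lam n0) <=
      s 0%N * D M.
    have -> : D M = \sum_(i < M) (partial_weight lam (n0 + i).+1 -
        partial_weight lam (n0 + i)%N) / partial_weight lam (n0 + i).+1.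
      by apply: eq_bigr => i _; rewrite partial_weightS addrAC subrr add0r.
    apply: ratio_sum_ge_ln => // n.
    by rewrite partial_weightS lerDl ltW.
  have : s 0%N * D M <= s 0%N * (2 * c / (1 - c * t)).
    by rewrite ler_pM2l// ler_pdivlMr//; have := DB M; lra.
  lra.
move/cvgryPgt : Loo.
move=> /(_ (expR (ln (partial_weight lam n0) + s 0%N * (2 * c / (1 - c * t)))))[N _].
move=> /(_ (n0 + N)%N); rewrite /= leq_addl => /(_ isT).
by rewrite -[X in _ < X]lnK ?posrE// ltr_expR ltNge Lbound.
Qed.

(** * From finite sums to the Hardy constant *)

(** [M] is tied to f by [mean_seq] only, so for decreasing f the lemma can be applied to -f while
    [M] remains the mean of f. *)
Lemma is_hardy_constant_mean (R : realType) (f f1 f2 : R -> R) (p eta : R)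
    (lam : R^nat) (M : weighted_mean R) :
  smooth_increasing f f1 f2 -> p < 1 -> 0 <= eta < 1 -> W0 lam ->
  partial_weight lam n @[n --> \oo] --> +oo ->
  nonincreasing_seq (fun n => lam n / partial_weight lam n) ->
  lam n / partial_weight lam n @[n --> \oo] --> eta ->
  (forall x : R, 0 < x -> x * f2 x <= (p - 1) * f1 x) ->
  (forall e : R, 0 < e -> exists2 b : R, 0 < b &
    forall x, 0 < x <= b -> (p - e - 1) * f1 x <= x * f2 x) ->
  (forall x : R^nat, (forall n, 0 < x n) ->
    mean_seq f lam x (fun n => M n.+1 (fun i => x i) (fun i => lam i))) ->
  is_hardy_constant lam M (hardy_C p eta)%:E.
Proof.
move=> fs p1 e01 lW Loo ni rl chi_le chi_ge ME.
have l0 n : 0 <= lam n by case: lW.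
have C1 := hardy_C_gt1 p1 e01.
have el n : eta * partial_weight lam n <= lam n.
  rewrite -ler_pdivlMr ?partial_weight_gt0//.
  have := nonincreasing_cvgn_ge ni (cvgP _ rl) n.
  by rewrite (cvg_lim _ rl).
have lx0 (x : R^nat) n : (forall n, 0 < x n) -> 0 <= lam n * x n.
  by move=> x0; rewrite mulr_ge0// ltW.
have lG0 (x : R^nat) n : (forall n, 0 < x n) ->
    0 <= lam n * M n.+1 (fun i => x i) (fun i => lam i).
  by move=> x0; have [/ltW G0 _] := ME x x0 n; rewrite mulr_ge0.
split=> [x x0|C' HC'].
  apply: lime_le; first by apply: is_cvg_nneseries => n _ _; rewrite lee_fin lG0.
  apply: nearW => N; rewrite sumEFin big_mkord.
  apply: (@le_trans _ _ ((hardy_C p eta)%:E *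
      (\sum_(0 <= n < N) (lam n * x n)%:E))%E).
    rewrite sumEFin big_mkord -EFinM lee_fin.
    exact: (mean_seq_hardy N fs chi_le p1 e01 lW el x0 (ME x x0)).
  apply: lee_wpmul2l; first by rewrite lee_fin; lra.
  by apply: nneseries_lim_ge => n _ _; rewrite lee_fin lx0.
(* Reduction to a real c >= 1: take max(r, 1) if C' is a real r, and 1 if it is -oo. The value 1
   cannot dominate C, since C > 1. *)
suff claim c : 1 <= c -> (C' <= c%:E)%E -> hardy_C p eta <= c.
  case: C' claim {HC'} => [r| |] claim; rewrite ?leey//.
    have := claim (Num.max r 1); rewrite !lee_fin !le_max !lexx orbT/=.
    by move=> /(_ isT isT) /orP[//|]; rewrite leNgt C1.
  by have := claim 1 (lexx _) (leNye _); rewrite leNgt C1.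
move=> c1 C'c; apply: (hardy_constant_lower fs p1 e01 lW Loo ni rl chi_ge c1).
move=> x x0; eexists; first exact: ME.
move=> B xB N.
rewrite -lee_fin -(big_mkord xpredT
  (fun n => lam n * M n.+1 (fun i => x i) (fun i => lam i))) -sumEFin.
apply: (@le_trans _ _ (\sum_(0 <= n <oo)
    (lam n * M n.+1 (fun i => x i) (fun i => lam i))%:E)%E).
  by apply: nneseries_lim_ge => n _ _; rewrite lee_fin lG0.
apply: le_trans (HC' x x0) _.
have S0 : (0 <= \sum_(0 <= n <oo) (lam n * x n)%:E)%E.
  by apply: nneseries_ge0 => n _ _; rewrite lee_fin lx0.
apply: le_trans (lee_wpmul2r S0 C'c) _.
rewrite EFinM; apply: lee_wpmul2l; first by rewrite lee_fin; lra.
apply: lime_le; first by apply: is_cvg_nneseries => n _ _; rewrite lee_fin lx0.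
by apply: nearW => m; rewrite sumEFin big_mkord lee_fin.
Qed.

(** [pinv] is a right inverse with values in (0, oo) on the image of f; the witness G shows that the
    weighted average lies in that image. *)
Lemma quasiarith_mean_spec (R : realType) (f : R -> R) n (x w : 'I_n -> R) :
  \sum_(i < n) w i != 0 ->
  (exists G, 0 < G /\ f G * (\sum_(i < n) w i) = \sum_(i < n) w i * f (x i)) ->
  0 < quasiarith_mean f x w /\
  f (quasiarith_mean f x w) * (\sum_(i < n) w i) = \sum_(i < n) w i * f (x i).
Proof.
move=> w0 [G [G0 GE]]; rewrite /quasiarith_mean -GE mulfK//.
have fG : (f @` [set t | 0 < t]) (f G) by exists G.
split; last by rewrite pinvK// inE.
apply: (@surjpinv_image_sub _ _ (fun=> point) [set t : R | 0 < t]
  (f @` [set t | 0 < t]) f _) => //.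
Qed.

Lemma neq0_continuous_sign (R : realType) (g g1 : R -> R) :
  (forall x : R, 0 < x -> is_derive x 1 g (g1 x)) ->
  (forall x : R, 0 < x -> g x != 0) ->
  (forall x : R, 0 < x -> 0 < g x) \/ (forall x : R, 0 < x -> g x < 0).
Proof.
move=> dg g0.
have cont (a b : R) : 0 < a -> {within `[a, b], continuous g}.
  move=> a0; apply: derivable_within_continuous => z; rewrite in_itv/= => /andP[az _].
  by have [] := dg z (lt_le_trans a0 az).
have same (x y : R) : 0 < x -> 0 < y -> x <= y -> (0 < g x) = (0 < g y).
  move=> x0 y0 xy; have [//|sxy] := eqVneq (0 < g x) (0 < g y).
  have [|c] := @IVT R g x y 0 xy (cont x y x0).
    rewrite ge_min le_max.
    have := g0 _ x0; have := g0 _ y0; move: sxy.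
    by case: (ltgtP (g x) 0) => //; case: (ltgtP (g y) 0).
  rewrite in_itv/= => /andP[xc _] gc.
  by have := g0 c (lt_le_trans x0 xc); rewrite gc eqxx.
have all1 (x : R) : 0 < x -> (0 < g x) = (0 < g 1).
  move=> x0; have [x1|/ltW x1] := leP x 1; first exact: same.
  by rewrite (same 1 x).
have [g1p|g1n] := ltP 0 (g 1); [left|right] => x x0; first by rewrite all1.
by rewrite lt_neqAle g0//= leNgt all1// -leNgt.
Qed.

Theorem corollary5p3 (R : realType) (lam : R^nat) (eta : R)
    (f : R -> R) (p : R)
    (lam_W0 : W0 lam)
    (Lam_oo : partial_weight lam n @[n --> \oo] --> +oo)
    (ratio_nonincr : nonincreasing_seq (fun n => lam n / partial_weight lam n))
    (ratio_cvg : lam n / partial_weight lam n @[n --> \oo] --> eta)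
    (eta_ge0 : 0 <= eta) (eta_lt1 : eta < 1)
    (f_C2 : C2_on_pos f)
    (f'_neq0 : forall x : R, 0 < x -> (f^`())%classic x != 0)
    (chi_cvg : chi f x @[x --> 0^'+] --> p)
    (p_lt1 : p < 1)
    (chi_le : forall x : R, 0 < x -> chi f x <= p) :
  is_hardy_constant lam (quasiarith_mean f) (hardy_C p eta)%:E.
Proof.
pose f1 : R -> R := (f^`())%classic; pose f2 : R -> R := (f^`(2))%classic.
have df (x : R) : 0 < x -> is_derive x 1 f (f1 x).
  by move=> /f_C2[d _ _]; rewrite /f1 derive1E; exact: derivableP.
have df1 (x : R) : 0 < x -> is_derive x 1 f1 (f2 x).
  move=> /f_C2[_ d _]; rewrite /f2 derive1nS derive1n1 derive1E.
  exact: derivableP.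
have lam0 n : \sum_(i < n.+1) lam i != 0.
  by rewrite gt_eqF// (partial_weight_gt0 n lam_W0).
have chi_near (e : R) : 0 < e -> exists2 b : R, 0 < b &
    forall x, 0 < x <= b -> p - e <= chi f x.
  move=> e0; have pe : p - e < p by lra.
  have [b /= b0 Hb] := cvgr_gt _ chi_cvg _ pe.
  (* The neighbourhood is the open condition |x| < b; halving allows the closed endpoint. *)
  exists (b / 2); first by lra.
  move=> x /andP[x0 xb]; apply/ltW/Hb => //=.
  by rewrite sub0r normrN gtr0_norm//; lra.
have chiE (x : R) : 0 < x -> x * f2 x = (chi f x - 1) * f1 x.
  by move=> x0; rewrite /chi addrK divfK// f'_neq0.
have e01 : 0 <= eta < 1 by rewrite eta_ge0.
have [f1_gt0|f1_lt0] := neq0_continuous_sign df1 f'_neq0.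
- have fs : smooth_increasing f f1 f2.
    by move=> x x0; split; [exact: df|exact: df1|exact: f1_gt0].
  apply: (is_hardy_constant_mean fs) => //.
  + move=> x x0; rewrite chiE// ler_pM2r ?f1_gt0// lerB//; exact: chi_le.
  + move=> e /chi_near[b b0 Hb]; exists b => // x /andP[x0 xb].
    by rewrite chiE// ler_pM2r ?f1_gt0// lerB// Hb// x0.
  + move=> x x0 n; apply: quasiarith_mean_spec; first exact: lam0.
    exact: (mean_seq_exists fs).
(* Passing to -f changes the sign of both derivatives, so chi_f is preserved, and the mean equation
   for f is that for -f negated. *)
- have fs : smooth_increasing (- f) (- f1) (- f2).
    move=> x x0; split; first by have := df x x0 => ?; exact: is_deriveN.
      by have := df1 x x0 => ?; exact: is_deriveN.
    by rewrite oppr_gt0 f1_lt0.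
  have sumN n (x : R^nat) : \sum_(k < n.+1) lam k * (- f) (x k) =
      - \sum_(k < n.+1) lam k * f (x k).
    by rewrite -sumrN; apply: eq_bigr => k _; rewrite mulrN.
  have Nf1_gt0 (x : R) : 0 < x -> 0 < (- f1) x by move=> /f1_lt0; rewrite oppr_gt0.
  have chiNE (x : R) : 0 < x -> x * (- f2) x = (chi f x - 1) * (- f1) x.
    by move=> x0; rewrite !mulrN chiE.
  apply: (is_hardy_constant_mean fs) => //.
  + move=> x x0; rewrite chiNE// ler_pM2r ?Nf1_gt0// lerB//; exact: chi_le.
  + move=> e /chi_near[b b0 Hb]; exists b => // x /andP[x0 xb].
    by rewrite chiNE// ler_pM2r ?Nf1_gt0// lerB// Hb// x0.
  + move=> x x0 n.
    have [||q0 qE] := @quasiarith_mean_spec R f n.+1 (fun i => x i) (fun i => lam i).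
    * exact: lam0.
    * have [G [G0 GE]] := mean_seq_exists fs lam_W0 x0 n.
      exists G; split=> //; apply: oppr_inj.
      by rewrite -sumN -GE -mulNr.
    * by split=> //; rewrite sumN -qE -mulNr.
Qed.
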